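(* Let $c>30+\sqrt{1302}$, let $T$ satisfy \[ \log T\;\ge\;\max\left\{C\sqrt{\frac{\log(C\sqrt{T})}{\log(1/\alpha)}+1},\;\left(\frac{\log(C\sqrt{T})}{\log(1/\alpha)}+1\right)^{3/4}\right\}, \] and run TD(0) with $\boldsymbol\theta_0=0$ and $\eta_t=\dfrac{1}{c\,\phi_\infty^2\log T\log(t+3)\sqrt{t+1}}$. Then for every $t\le T$, \[ \mathbb E\big[\|\boldsymbol\theta_t\|_2^2\big]\le\omega_c^2\max\Big\{\frac{r_\infty^2}{\phi_\infty^2},\ \|\boldsymbol\theta^*\|_2^2\Big\}, \] where \[ \omega_c=\frac{2c^2+72c+417}{2c^2-120c-804}+\sqrt{\frac{4c^4+504c^3-5668c^2-53184c-2991}{4(c^2-60c-402)^2}}. \] Moreover $\omega_c\to2$ as $c\to\infty$ and $\omega_c\to\infty$ as $c\downarrow30+\sqrt{1302}$.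
   Context: Setting. $\mathcal S=\{1,\dots,n\}$ finite; $\boldsymbol P$ the transition matrix of the Markov chain induced by a fixed policy, irreducible and aperiodic with stationary distribution $\boldsymbol\pi$; $C>0,\alpha\in(0,1)$ with $\|\boldsymbol P^t(s,\cdot)-\boldsymbol\pi\|_{\mathrm{TV}}\le C\alpha^t$ for all $s,t$. Discount $\gamma\in(0,1)$; rewards $0\le r(s,s')\le r_\infty$; features $\boldsymbol\phi(s)\in\mathbb R^d$ with $\|\boldsymbol\phi(s)\|_2\le\phi_\infty$ and feature matrix $\boldsymbol\Phi$ (rows $\boldsymbol\phi(s)^\top$) of full column rank. $\bar{\boldsymbol g}(\boldsymbol\theta)=\sum_{s,s'}\pi(s)P(s,s')(r(s,s')+\gamma\boldsymbol\phi(s')^\top\boldsymbol\theta-\boldsymbol\phi(s)^\top\boldsymbol\theta)\boldsymbol\phi(s)$ and $\boldsymbol\theta^*$ is the unique zero of $\bar{\boldsymbol g}$ (the TD fixed point). TD(0): $s_0,s_1,\dots$ a trajectory of the chain, $O_t=(s_t,s_{t+1})$, $\boldsymbol g(\boldsymbol\theta,(s,s'))=(r(s,s')+\gamma\boldsymbol\phi(s')^\top\boldsymbol\theta-\boldsymbol\phi(s)^\top\boldsymbol\theta)\boldsymbol\phi(s)$, $\boldsymbol\theta_{t+1}=\boldsymbol\theta_t+\eta_t\boldsymbol g(\boldsymbol\theta_t,O_t)$. Logarithms are natural. *)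

(* Defs.v *)
From HB Require Import structures.
From mathcomp Require Import all_boot all_order all_algebra.
From mathcomp Require Import all_classical all_reals all_analysis.
Set Implicit Arguments. Unset Strict Implicit. Unset Printing Implicit Defensive.
Import Order.TTheory GRing.Theory Num.Theory.
Import numFieldNormedType.Exports.
Local Open Scope ring_scope.

Section TD.
Variables (R : realType) (S : finType).

Fixpoint Pow (P : S -> S -> R) (k : nat) (s s' : S) : R :=
  match k with
  | 0 => (s == s')%:R
  | k.+1 => \sum_(u : S) Pow P k s u * P u s'
  end.

Definition stochastic (P : S -> S -> R) : Prop :=
  (forall s s', 0 <= P s s') /\ (forall s, \sum_(s' : S) P s s' = 1).

Definition prob_vec (mu : S -> R) : Prop :=
  (forall s, 0 <= mu s) /\ \sum_(s : S) mu s = 1.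

Definition irreducible (P : S -> S -> R) : Prop :=
  forall s s', exists k : nat, 0 < Pow P k s s'.

(* period of every state is 1: the gcd of {k > 0 | P^k(s,s) > 0} is 1 *)
Definition aperiodic (P : S -> S -> R) : Prop :=
  forall (s : S) (d : nat),
    (forall k : nat, (0 < k)%N -> 0 < Pow P k s s -> (d %| k)%N) -> d = 1%N.

Definition stationary (P : S -> S -> R) (pi : S -> R) : Prop :=
  prob_vec pi /\ (forall s', \sum_(s : S) pi s * P s s' = pi s').

Definition tv_dist (mu nu : S -> R) : R :=
  2^-1 * \sum_(s : S) `|mu s - nu s|.

Definition dotv (d : nat) (u v : 'cV[R]_d) : R := \sum_(i < d) u i ord0 * v i ord0.
Definition norm2 (d : nat) (u : 'cV[R]_d) : R := Num.sqrt (dotv u u).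

Definition feat_mx (d : nat) (phi : S -> 'cV[R]_d) : 'M[R]_(#|S|, d) :=
  \matrix_(i, j) phi (enum_val i) j ord0.

Definition td_g (d : nat) (gamma : R) (r : S -> S -> R) (phi : S -> 'cV[R]_d)
  (theta : 'cV[R]_d) (s s' : S) : 'cV[R]_d :=
  (r s s' + gamma * dotv (phi s') theta - dotv (phi s) theta) *: phi s.

Definition td_gbar (d : nat) (P : S -> S -> R) (pi : S -> R) (gamma : R)
  (r : S -> S -> R) (phi : S -> 'cV[R]_d) (theta : 'cV[R]_d) : 'cV[R]_d :=
  \sum_(s : S) \sum_(s' : S) (pi s * P s s') *: td_g gamma r phi theta s s'.

Fixpoint td_theta (d : nat) (gamma : R) (r : S -> S -> R) (phi : S -> 'cV[R]_d)
  (eta : nat -> R) (x : nat -> S) (t : nat) : 'cV[R]_d :=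
  match t with
  | 0 => 0
  | t'.+1 => let th := td_theta gamma r phi eta x t' in
             th + eta t' *: td_g gamma r phi th (x t') (x t'.+1)
  end.

Definition path_weight (mu : S -> R) (P : S -> S -> R) (t : nat)
  (p : {ffun 'I_t.+1 -> S}) : R :=
  mu (p ord0) * \prod_(i < t) P (p (widen_ord (leqnSn t) i)) (p (lift ord0 i)).

Definition traj_expect (mu : S -> R) (P : S -> S -> R) (t : nat)
  (f : (nat -> S) -> R) : R :=
  \sum_(p : {ffun 'I_t.+1 -> S}) path_weight mu P p * f (fun k => p (inord k)).

End TD.

Definition omega_c {R : realType} (c : R) : R :=
  (2 * c ^+ 2 + 72 * c + 417) / (2 * c ^+ 2 - 120 * c - 804)
  + Num.sqrt ((4 * c ^+ 4 + 504 * c ^+ 3 - (4 * 1417) * c ^+ 2 - (64 * 831) * c - 2991)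
              / (4 * (c ^+ 2 - 60 * c - 402) ^+ 2)).

(* Main.v *)
Require Import Defs.
From HB Require Import structures.
From mathcomp Require Import all_boot all_order all_algebra.
From mathcomp Require Import all_classical all_reals all_analysis.
From mathcomp Require Import ring lra zify.
Import Order.TTheory GRing.Theory Num.Theory.
Import numFieldNormedType.Exports.
Local Open Scope classical_set_scope.
Local Open Scope ring_scope.

(** Put rho = max (r_inf / phi_inf) |theta*|.  The quadratic equation behind [omega_c] reads
    w^2 - 2w = (60 w^2 + 72 w + 54) / c + (402 w^2 + 417 w + 110) / c^2.
    Assume E|theta_i|^2 <= (w rho)^2 for all i < t.  Expanding |theta_{i+1} - theta*|^2 and using
    that the mean update points towards theta*, E|theta_t - theta*|^2 exceeds |theta*|^2 at most by
    the second-order terms and the Markov noise.  Before a mixing time tau the noise is bounded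
    crudely; afterwards theta_i is replaced by theta_{i-tau}, on which (s_i, s_{i+1}) depends only
    up to total variation 1 / sqrt T.  Since tau <= 4 (log T)^2, the sum of all these errors is at
    most rho^2 times the right-hand side above, that is, E|theta_t - theta*|^2 <= ((w - 1) rho)^2,
    and Minkowski's inequality closes the induction. *)

(** * Cauchy-Schwarz and Minkowski inequalities for finite weighted sums *)

Section WeightedSums.
Context {R : realType} {I : finType} (w : I -> R).
Hypothesis w_ge0 : forall i, 0 <= w i.

(** Where a weight vanishes nothing is known about [X i], so only the product [w i * X i] can be
    shown to be zero. *)
Lemma wsum_sq_eq0 (X : I -> R) :
  \sum_i w i * X i ^+ 2 <= 0 -> forall i, w i * X i = 0.
Proof.
move=> h i.
have h0 : \sum_i w i * X i ^+ 2 = 0.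
  by apply/eqP; rewrite eq_le h sumr_ge0// => j _; rewrite mulr_ge0// sqr_ge0.
have /eqP := psumr_eq0P (fun j _ => mulr_ge0 (w_ge0 j) (sqr_ge0 (X j))) h0 (i := i) isT.
by rewrite mulf_eq0 expf_eq0/= => /orP[]/eqP->; rewrite ?mul0r ?mulr0.
Qed.

(** Summing w_i (b X_i - a Y_i)^2 >= 0 and dividing by 2ab gives the claim; the cases a = 0 and b =
    0 are treated apart. Bounds [a], [b] stand in place of square roots because the applications
    only know upper bounds on second moments. *)
Lemma wsum_cauchy_schwarz (X Y : I -> R) (a b : R) : 0 <= a -> 0 <= b ->
  \sum_i w i * X i ^+ 2 <= a ^+ 2 -> \sum_i w i * Y i ^+ 2 <= b ^+ 2 ->
  \sum_i w i * (X i * Y i) <= a * b.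
Proof.
move=> a0 b0 hX hY.
have [a00|a_neq0] := eqVneq a 0.
  rewrite a00 expr0n/= in hX; rewrite a00 mul0r big1// => i _.
  by rewrite mulrA wsum_sq_eq0 ?mul0r.
have [b00|b_neq0] := eqVneq b 0.
  rewrite b00 expr0n/= in hY; rewrite b00 mulr0 big1// => i _.
  by rewrite mulrCA wsum_sq_eq0 ?mulr0.
have ap : 0 < a by rewrite lt0r a_neq0.
have bp : 0 < b by rewrite lt0r b_neq0.
have ab : 0 < a * b by exact: mulr_gt0.
have le1 : 2 * (a * b) * \sum_i w i * (X i * Y i) <=
    b ^+ 2 * (\sum_i w i * X i ^+ 2) + a ^+ 2 * (\sum_i w i * Y i ^+ 2).
  rewrite !mulr_sumr -big_split/= ler_sum// => i _.
  rewrite -subr_ge0.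
  have -> : b ^+ 2 * (w i * X i ^+ 2) + a ^+ 2 * (w i * Y i ^+ 2)
      - 2 * (a * b) * (w i * (X i * Y i)) = w i * (b * X i - a * Y i) ^+ 2 by ring.
  by rewrite mulr_ge0// sqr_ge0.
have le2 : 2 * (a * b) * \sum_i w i * (X i * Y i) <= 2 * (a * b) * (a * b).
  apply: (le_trans le1).
  have -> : 2 * (a * b) * (a * b) = b ^+ 2 * a ^+ 2 + a ^+ 2 * b ^+ 2 by ring.
  by apply: lerD; rewrite ler_wpM2l// sqr_ge0.
by rewrite -(ler_pM2l (x := 2 * (a * b)))// mulr_gt0.
Qed.

Lemma wsum_minkowski (X Y : I -> R) (a b : R) : 0 <= a -> 0 <= b ->
  \sum_i w i * X i ^+ 2 <= a ^+ 2 -> \sum_i w i * Y i ^+ 2 <= b ^+ 2 ->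
  \sum_i w i * (X i + Y i) ^+ 2 <= (a + b) ^+ 2.
Proof.
move=> a0 b0 hX hY.
have hXY := wsum_cauchy_schwarz _ _ _ _ a0 b0 hX hY.
have -> : \sum_i w i * (X i + Y i) ^+ 2 = \sum_i w i * X i ^+ 2
    + 2 * (\sum_i w i * (X i * Y i)) + \sum_i w i * Y i ^+ 2.
  rewrite mulr_sumr -!big_split/=; apply: eq_bigr => i _; ring.
have -> : (a + b) ^+ 2 = a ^+ 2 + 2 * (a * b) + b ^+ 2 by ring.
lra.
Qed.

End WeightedSums.

(** * Inner product and Euclidean norm of column vectors *)

Section Euclidean.
Context {R : realType} {d : nat}.
Implicit Types u v : 'cV[R]_d.

Lemma dotvC u v : dotv u v = dotv v u.
Proof. by apply: eq_bigr => i _; rewrite mulrC. Qed.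

Lemma dotvDl u u' v : dotv (u + u') v = dotv u v + dotv u' v.
Proof. by rewrite -big_split/=; apply: eq_bigr => i _; rewrite mxE mulrDl. Qed.

Lemma dotvZl k u v : dotv (k *: u) v = k * dotv u v.
Proof. by rewrite mulr_sumr; apply: eq_bigr => i _; rewrite mxE mulrA. Qed.

Lemma dotvDr u v v' : dotv u (v + v') = dotv u v + dotv u v'.
Proof. by rewrite dotvC dotvDl !(dotvC u). Qed.

Lemma dotvZr k u v : dotv u (k *: v) = k * dotv u v.
Proof. by rewrite dotvC dotvZl dotvC. Qed.

Lemma dotvNl u v : dotv (- u) v = - dotv u v.
Proof. by rewrite -scaleN1r dotvZl mulN1r. Qed.

Lemma dotvNr u v : dotv u (- v) = - dotv u v.
Proof. by rewrite dotvC dotvNl dotvC. Qed.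

Lemma dotv0r u : dotv u 0 = 0.
Proof. by rewrite -(scale0r 0) dotvZr mul0r. Qed.

Lemma dotv_sumr (J : finType) u (F : J -> 'cV[R]_d) :
  dotv u (\sum_j F j) = \sum_j dotv u (F j).
Proof.
by apply: (big_morph (dotv u) (dotvDr u)); exact: dotv0r.
Qed.

Lemma dotv_ge0 u : 0 <= dotv u u.
Proof. by apply: sumr_ge0 => i _; rewrite -expr2 sqr_ge0. Qed.

Lemma norm2_ge0 u : 0 <= norm2 u. Proof. exact: sqrtr_ge0. Qed.

Lemma sqr_norm2 u : norm2 u ^+ 2 = dotv u u.
Proof. by rewrite sqr_sqrtr// dotv_ge0. Qed.

Lemma norm2_0 : norm2 (0 : 'cV[R]_d) = 0.
Proof. by rewrite /norm2 dotv0r sqrtr0. Qed.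

Lemma norm2Z k u : norm2 (k *: u) = `|k| * norm2 u.
Proof. by rewrite /norm2 dotvZl dotvZr mulrA -expr2 sqrtrM ?sqr_ge0// sqrtr_sqr. Qed.

Lemma norm2N u : norm2 (- u) = norm2 u.
Proof. by rewrite -scaleN1r norm2Z normrN1 mul1r. Qed.

Lemma dotv_le u v : dotv u v <= norm2 u * norm2 v.
Proof.
have h (z : 'cV[R]_d) : \sum_(i < d) 1 * z i ord0 ^+ 2 <= norm2 z ^+ 2.
  by rewrite sqr_norm2 le_eqVlt; apply/orP; left; apply/eqP; apply: eq_bigr => i _; rewrite mul1r.
have := wsum_cauchy_schwarz (fun=> 1) (fun=> ler01) _ _ _ _
  (norm2_ge0 u) (norm2_ge0 v) (h u) (h v).
by under eq_bigr do rewrite mul1r.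
Qed.

Lemma normr_dotv_le u v : `|dotv u v| <= norm2 u * norm2 v.
Proof.
rewrite ler_norml dotv_le andbT lerNl -dotvNl.
by rewrite (le_trans (dotv_le _ _))// norm2N.
Qed.

Lemma norm2D u v : norm2 (u + v) <= norm2 u + norm2 v.
Proof.
rewrite -(ler_pXn2r (n := 2))// ?nnegrE ?norm2_ge0 ?addr_ge0 ?norm2_ge0//.
rewrite sqr_norm2 sqrrD !sqr_norm2 dotvDl !dotvDr (dotvC v u) -mulr_natl.
have := dotv_le u v; lra.
Qed.

Lemma norm2B u v : norm2 (u - v) <= norm2 u + norm2 v.
Proof. by rewrite (le_trans (norm2D _ _))// norm2N. Qed.

End Euclidean.

(** * Expectation along trajectories *)

Lemma prob_vec_inhabited {R : realType} {S : finType} (mu : S -> R) :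
  prob_vec mu -> exists s : S, true.
Proof.
case=> _ mu1; have [s _|S0] := pickP S; first by exists s.
by move/eqP: mu1; rewrite big_pred0// eq_sym oner_eq0.
Qed.

Section Trajectories.
Context {R : realType} {S : finType}.
Variables (P : S -> S -> R) (mu : S -> R).
Hypotheses (P_stoch : stochastic P) (mu_prob : prob_vec mu).

Local Notation E := (traj_expect mu P).

(** Measurability with respect to the states s_0, ..., s_n, phrased for functionals of infinite
    sequences. *)
Definition adapted {A : Type} (n : nat) (F : (nat -> S) -> A) :=
  forall x y, (forall i, (i <= n)%N -> x i = y i) -> F x = F y.

Definition upd (x : nat -> S) (n : nat) (s : S) := fun k => if k == n then s else x k.

Lemma adapted_le {A : Type} {m n : nat} {F : (nat -> S) -> A} :
  (m <= n)%N -> adapted m F -> adapted n F.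
Proof. by move=> mn Fm x y xy; apply: Fm => i im; apply: xy; apply: leq_trans mn. Qed.

Lemma adapted_upd {A : Type} (m n : nat) (F : (nat -> S) -> A) x s :
  (m < n)%N -> adapted m F -> F (upd x n s) = F x.
Proof.
move=> mn Fm; apply: Fm => i im; rewrite /upd ifN//.
by rewrite neq_ltn (leq_ltn_trans im mn).
Qed.

Lemma path_weight_ge0 n (p : {ffun 'I_n.+1 -> S}) : 0 <= path_weight mu P p.
Proof. by rewrite mulr_ge0 ?mu_prob.1// prodr_ge0// => i _; exact: P_stoch.1. Qed.

Lemma traj_expect_le n F G : (forall x, F x <= G x) -> E n F <= E n G.
Proof. by move=> FG; apply: ler_sum => p _; rewrite ler_wpM2l// path_weight_ge0. Qed.

Lemma eq_traj_expect n F G : (forall x, F x = G x) -> E n F = E n G.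
Proof. by move=> FG; apply: eq_bigr => p _; rewrite FG. Qed.

Lemma traj_expectD n F G : E n (fun x => F x + G x) = E n F + E n G.
Proof. by rewrite -big_split/=; apply: eq_bigr => p _; rewrite mulrDr. Qed.

Lemma traj_expectZ n k F : E n (fun x => k * F x) = k * E n F.
Proof. by rewrite mulr_sumr; apply: eq_bigr => p _; rewrite mulrCA. Qed.

(** One-step conditioning: the last state is integrated out given the state before it. Adaptedness
    matters because [traj_expect] at a given horizon reads [p ord0], through [inord], at every index
    beyond that horizon. *)
Lemma traj_expectS n F : adapted n.+1 F ->
  E n.+1 F = E n (fun x => \sum_s P (x n) s * F (upd x n.+1 s)).
Proof.
move=> Fn; rewrite /traj_expect.
(* A path with n+2 states is a path with n+1 states together with a final state; [h] and [g] are the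
   two directions of this bijection. *)
pose h (ps : {ffun 'I_n.+1 -> S} * S) : {ffun 'I_n.+2 -> S} :=
  [ffun i : 'I_n.+2 => if (i <= n)%N then ps.1 (inord i) else ps.2].
pose g (q : {ffun 'I_n.+2 -> S}) : {ffun 'I_n.+1 -> S} * S :=
  ([ffun i : 'I_n.+1 => q (inord i)], q ord_max).
have hgK : cancel h g.
  case=> p s; rewrite /h /g; congr pair; last by rewrite ffunE/= ltnn.
  apply/ffunP => i; rewrite !ffunE inordK ?(ltn_trans (ltn_ord i))//.
  by rewrite -ltnS ltn_ord/= inord_val.
have ghK : cancel g h.
  move=> q; apply/ffunP => i; rewrite ffunE/= ffunE; case: leqP => ni.
    by rewrite inordK// inord_val.
  congr (q _); apply/val_inj => /=; apply/eqP; rewrite eqn_leq ni/=.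
  by rewrite -ltnS ltn_ord.
rewrite (reindex h)/=; last by exists g => ? _; [exact: hgK|exact: ghK].
rewrite -(pair_bigA _ (fun p s => path_weight mu P (h (p, s)) *
  F (fun k => h (p, s) (inord k))))/=.
apply: eq_bigr => p _; rewrite mulr_sumr; apply: eq_bigr => s _.
rewrite mulrA; congr (_ * _); last first.
  apply: Fn => i; rewrite /upd leq_eqVlt => /orP[/eqP->|i_lt].
    by rewrite eqxx ffunE inordK// ltnn.
  rewrite ifN ?neq_ltn ?i_lt// ffunE inordK ?(ltn_trans i_lt)//.
  by rewrite -ltnS i_lt.
rewrite /path_weight big_ord_recr/= -!mulrA; congr (_ * _).
  by rewrite ffunE/=; congr (mu (p _)); apply/val_inj; rewrite /= inordK.
congr (_ * _).
  apply: eq_bigr => i _; congr P; rewrite ffunE/=.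
    rewrite (ltnW (ltn_ord i)); congr (p _); apply/val_inj => /=.
    by rewrite inordK// ltnW// ltnS ltn_ord.
  rewrite /bump/= add1n ltn_ord; congr (p _); apply/val_inj => /=.
  by rewrite inordK// ltnS ltn_ord.
congr P; rewrite ffunE/=; last by rewrite /bump/= add1n ltnn.
by rewrite leqnn.
Qed.

(** States after time m integrate out because the rows of [P] sum to one. This allows functionals of
    different times to be compared at a common horizon. *)
Lemma traj_expect_widen {m n : nat} {F} : (m <= n)%N -> adapted m F -> E n F = E m F.
Proof.
move=> mn Fm; elim: n mn => [|n IH]; first by rewrite leqn0 => /eqP->.
rewrite leq_eqVlt => /orP[/eqP->//|]; rewrite ltnS => mn.
rewrite traj_expectS; last exact: adapted_le (leqW mn) Fm.
rewrite -IH//.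
apply: eq_traj_expect => x.
under eq_bigr do rewrite (adapted_upd m)//.
by rewrite -mulr_suml P_stoch.2 mul1r.
Qed.

Lemma traj_expect_cst n k : E n (fun=> k) = k.
Proof.
rewrite (@traj_expect_widen 0)// /traj_expect.
rewrite -mulr_suml -[RHS]mul1r; congr (_ * _); rewrite -mu_prob.2.
under eq_bigr do rewrite /path_weight big_ord0 mulr1.
rewrite (reindex (fun s : S => [ffun=> s] : {ffun 'I_1 -> S}))/=.
  by apply: eq_bigr => s _; rewrite ffunE.
exists (fun p : {ffun 'I_1 -> S} => p ord0) => p _; first by rewrite ffunE.
by apply/ffunP => i; rewrite ffunE; congr (p _); rewrite (ord1 i).
Qed.

(** The Markov property, with the past up to time k frozen in the first argument of [G]. The
    induction on m generalizes [G]: the last transition is absorbed into the integrand, matching the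
    recursion of [Pow], which appends a step on the right. *)
Lemma traj_expect_markov k m (G : (nat -> S) -> S -> R) :
  (forall s, adapted k (G^~ s)) ->
  E (k + m)%N (fun x => G x (x (k + m)%N)) =
  E k (fun x => \sum_s Pow P m (x k) s * G x s).
Proof.
elim: m G => [|m IH] G Gk.
  rewrite addn0; apply: eq_traj_expect => x /=.
  rewrite (bigD1 (x k))//= eqxx mul1r big1 ?addr0// => s /negPf.
  by rewrite eq_sym => ->; rewrite mul0r.
rewrite addnS traj_expectS; last first.
  move=> x y xy; rewrite xy//; apply: Gk => i ik.
  by apply: xy; rewrite (leq_trans ik)// -addnS leq_addr.
transitivity (E (k + m)%N (fun x => \sum_s P (x (k + m)%N) s * G x s)).
  apply: eq_traj_expect => x; apply: eq_bigr => s _; congr (_ * _).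
  rewrite {2}/upd eqxx; apply: (adapted_upd k (k + m).+1 (G^~ s)) => //.
  by rewrite ltnS leq_addr.
rewrite (IH (fun x u => \sum_s P u s * G x s)); last first.
  by move=> u x y xy; apply: eq_bigr => s _; rewrite (Gk s _ _ xy).
apply: eq_traj_expect => x.
under eq_bigr do rewrite mulr_sumr.
rewrite exchange_big/=; apply: eq_bigr => s _.
by rewrite mulr_suml; apply: eq_bigr => u _; rewrite mulrA.
Qed.

(** The Markov property for a pair of consecutive states, which is what one update observes. *)
Lemma traj_expect_transition k m (G : (nat -> S) -> S -> S -> R) :
  (forall s s', adapted k (fun x => G x s s')) ->
  E (k + m).+1 (fun x => G x (x (k + m)%N) (x (k + m).+1)) =
  E k (fun x => \sum_s Pow P m (x k) s * \sum_s' P s s' * G x s s').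
Proof.
move=> Gk; rewrite traj_expectS; last first.
  move=> x y xy; rewrite !xy//; apply: Gk => i ik.
  by apply: xy; rewrite (leq_trans ik)// -addnS leq_addr.
rewrite -(traj_expect_markov k m (fun x s => \sum_s' P s s' * G x s s')); last first.
  by move=> u x y xy; apply: eq_bigr => s _; rewrite (Gk u s _ _ xy).
apply: eq_traj_expect => x; apply: eq_bigr => s _; congr (_ * _).
rewrite {2 3}/upd eqxx ifN ?neq_ltn ?ltnSn//.
apply: (adapted_upd k (k + m).+1 (fun y => G y (x (k + m)%N) s)) => //.
by rewrite ltnS leq_addr.
Qed.

Lemma traj_expect_cauchy_schwarz n X Y (a b : R) : 0 <= a -> 0 <= b ->
  E n (fun x => X x ^+ 2) <= a ^+ 2 -> E n (fun x => Y x ^+ 2) <= b ^+ 2 ->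
  E n (fun x => X x * Y x) <= a * b.
Proof.
exact: (wsum_cauchy_schwarz (fun p => path_weight mu P p)
  (path_weight_ge0 n) (fun p => X (fun k => p (inord k))) (fun p => Y (fun k => p (inord k)))).
Qed.

Lemma traj_expect_minkowski n X Y (a b : R) : 0 <= a -> 0 <= b ->
  E n (fun x => X x ^+ 2) <= a ^+ 2 -> E n (fun x => Y x ^+ 2) <= b ^+ 2 ->
  E n (fun x => (X x + Y x) ^+ 2) <= (a + b) ^+ 2.
Proof.
exact: (wsum_minkowski (fun p => path_weight mu P p)
  (path_weight_ge0 n) (fun p => X (fun k => p (inord k))) (fun p => Y (fun k => p (inord k)))).
Qed.

End Trajectories.

(** * Truncated and shifted sums of nonnegative terms *)

Section PartialSums.
Context {R : realType} (u : nat -> R).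
Hypothesis u_ge0 : forall i, 0 <= u i.

Lemma ler_sum_widen m n : (m <= n)%N -> \sum_(i < m) u i <= \sum_(i < n) u i.
Proof.
move/subnKC <-; elim: (n - m)%N => [|k IH]; first by rewrite addn0.
by rewrite addnS big_ord_recr/= (le_trans IH)// lerDl.
Qed.

Lemma ler_sum_head n tau :
  \sum_(i < n) (if (i < tau)%N then u i else 0) <= \sum_(i < tau) u i.
Proof.
suff -> : \sum_(i < n) (if (i < tau)%N then u i else 0) = \sum_(i < minn n tau) u i.
  by apply: ler_sum_widen; rewrite geq_minr.
elim: n => [|n IH]; first by rewrite min0n !big_ord0.
rewrite big_ord_recr/= IH; case: ifPn => h.
  have -> : minn n tau = n by lia.
  have -> : minn n.+1 tau = n.+1 by lia.
  by rewrite big_ord_recr.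
by rewrite addr0 (_ : minn n.+1 tau = minn n tau)//; lia.
Qed.

(** For tau <= n the left side runs over the indices from j up to n - tau + j, a window inside the
    first n indices since j <= tau; for tau > n every term on the left is zero. *)
Lemma ler_sum_shift n tau j : (j <= tau)%N ->
  \sum_(i < n) (if (tau <= i)%N then u (i - tau + j)%N else 0) <= \sum_(i < n) u i.
Proof.
move=> jtau; case: (leqP tau n) => ntau; last first.
  rewrite big1 ?sumr_ge0// => i _; rewrite ifN// -ltnNge.
  by rewrite (ltn_trans (ltn_ord i)).
apply: (@le_trans _ _ (\sum_(i < n - tau + j) u i)); last first.
  by apply: ler_sum_widen; lia.
elim: n {ntau} => [|n IH]; first by rewrite big_ord0 sumr_ge0.
rewrite big_ord_recr/=; case: leqP => ntau.
  have -> : (n.+1 - tau + j = (n - tau + j).+1)%N by lia.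
  by rewrite big_ord_recr/= lerD2r.
rewrite addr0; have -> : (n.+1 - tau + j = n - tau + j)%N by lia.
exact: IH.
Qed.

End PartialSums.

(* Each product [a i * a j] is split by AM-GM, and every square occurs in at most [tau] pairs on each side. *)
Lemma sum_window_le {R : realType} (a : nat -> R) n tau :
  \sum_(i < n) (if (tau <= i)%N then a i * \sum_(j < tau) a (i - tau + j)%N else 0)
  <= tau%:R * \sum_(i < n) a i ^+ 2.
Proof.
pose q := \sum_(i < n) a i ^+ 2.
have sq0 i : 0 <= a i ^+ 2 by exact: sqr_ge0.
have h1 : \sum_(i < n) (if (tau <= i)%N then a i * \sum_(j < tau) a (i - tau + j)%N else 0)
  <= \sum_(j < tau) 2^-1 * (q + \sum_(i < n) (if (tau <= i)%N then a (i - tau + j)%N ^+ 2 else 0)).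
  rewrite -mulr_sumr big_split/= [X in _ + X]exchange_big/= [X in X + _]exchange_big/= -big_split/=.
  rewrite mulr_sumr; apply: ler_sum => i _; case: ifP => _; last first.
    by rewrite mulr_ge0 ?invr_ge0// addr_ge0// sumr_ge0.
  rewrite -big_split/= !mulr_sumr; apply: ler_sum => j _.
  have := sqr_ge0 (a i - a (i - tau + j)%N); lra.
apply: (le_trans h1).
rewrite (_ : tau%:R * _ = \sum_(j < tau) q); last by rewrite sumr_const card_ord mulr_natl.
apply: ler_sum => j _.
have := ler_sum_shift (fun i => a i ^+ 2) sq0 n tau j (ltnW (ltn_ord j)).
rewrite -/q; lra.
Qed.

(** * Second moments of a stochastic approximation driven by a mixing Markov chain *)

Section StochasticApproximation.
Context {R : realType} {S : finType} {d : nat}.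
Variables (P : S -> S -> R) (mu pi : S -> R).
Hypotheses (P_stoch : stochastic P) (mu_prob : prob_vec mu).
Variables (h : 'cV[R]_d -> S -> S -> 'cV[R]_d) (theta_star : 'cV[R]_d) (rho : R).
Hypothesis h_growth : forall th s s', norm2 (h th s s') <= rho + 2 * norm2 th.
Hypothesis h_lipschitz : forall th th' s s',
  norm2 (h th s s' - h th' s s') <= 2 * norm2 (th - th').
Hypothesis h_monotone : forall th,
  \sum_s pi s * \sum_s' P s s' * dotv (th - theta_star) (h th s s') <= 0.
Hypothesis theta_star_le : norm2 theta_star <= rho.
Variable a : nat -> R.
Hypothesis a_ge0 : forall i, 0 <= a i.
Variable theta : (nat -> S) -> nat -> 'cV[R]_d.
Hypothesis theta0 : forall x, theta x 0%N = 0.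
Hypothesis thetaS : forall x t,
  theta x t.+1 = theta x t + a t *: h (theta x t) (x t) (x t.+1).
Variables (tau : nat) (eps : R).
Hypothesis mixing : forall s, \sum_s' `|Pow P tau s s' - pi s'| <= 2 * eps.

Local Notation E := (traj_expect mu P).
Local Notation N x t := (norm2 (theta x t)).

Let rho_ge0 : 0 <= rho. Proof. exact: le_trans (norm2_ge0 _) theta_star_le. Qed.

Lemma theta_adapted t : adapted t (fun x => theta x t).
Proof.
elim: t => [|t IH] x y xy; first by rewrite !theta0.
by rewrite !thetaS (IH x y) ?xy// => i it; apply: xy; rewrite leqW.
Qed.

Lemma dotv_noise_le th s s' : dotv (th - theta_star) (h th s s') <=
  (rho + norm2 th) * (rho + 2 * norm2 th).
Proof.
rewrite (le_trans (dotv_le _ _))// ler_pM ?norm2_ge0//.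
by rewrite (le_trans (norm2B _ _))// addrC lerD2r.
Qed.

Lemma normr_dotv_noise_le th s s' : `|dotv (th - theta_star) (h th s s')| <=
  (rho + norm2 th) * (rho + 2 * norm2 th).
Proof.
rewrite (le_trans (normr_dotv_le _ _))// ler_pM ?norm2_ge0//.
by rewrite (le_trans (norm2B _ _))// addrC lerD2r.
Qed.

(** The triangle inequality in L^2; it turns a root-mean-square bound on the iterate into one on the
    affine factors that bound the update and the distance to [theta_star]. *)
Lemma rms_affine n X (b u v : R) : 0 <= b -> 0 <= u -> 0 <= v ->
  E n (fun x => X x ^+ 2) <= b ^+ 2 ->
  E n (fun x => (u + v * X x) ^+ 2) <= (u + v * b) ^+ 2.
Proof.
move=> b0 u0 v0 hX.
apply: traj_expect_minkowski => //; first exact: mulr_ge0.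
  by rewrite traj_expect_cst.
under eq_traj_expect do rewrite exprMn.
by rewrite traj_expectZ exprMn ler_wpM2l// sqr_ge0.
Qed.

Section Step.
Variable b : R.
Hypothesis b_ge0 : 0 <= b.

(** Bound on the mean product of |theta - theta_star| and the length of the update, for iterates of
    root-mean-square norm at most [b]. *)
Let M := (rho + b) * (rho + 2 * b).

Lemma expect_product_le n t : E n (fun x => N x t ^+ 2) <= b ^+ 2 ->
  E n (fun x => (rho + N x t) * (rho + 2 * N x t)) <= M.
Proof.
move=> hN; apply: traj_expect_cauchy_schwarz => //.
- by rewrite addr_ge0.
- by rewrite addr_ge0// mulr_ge0.
- have := rms_affine n (fun x => N x t) b rho 1 b_ge0 rho_ge0 ler01 hN.
  by under eq_traj_expect do rewrite mul1r; rewrite mul1r.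
- exact: rms_affine.
Qed.

(** The bound for times before [tau], when the chain has not yet mixed: Cauchy-Schwarz alone. *)
Lemma drift_crude n t : E n (fun x => N x t ^+ 2) <= b ^+ 2 ->
  E n (fun x => dotv (theta x t - theta_star) (h (theta x t) (x t) (x t.+1))) <= M.
Proof.
move=> /expect_product_le; apply: le_trans; apply: traj_expect_le => // x.
exact: dotv_noise_le.
Qed.

(** Minkowski's inequality applied one update at a time; the update at time m+j has root-mean-square
    length at most a_(m+j) (rho + 2b). *)
Lemma rms_increment n m k :
  (forall j, (j < m + k)%N -> E n (fun x => N x j ^+ 2) <= b ^+ 2) ->
  E n (fun x => norm2 (theta x (m + k)%N - theta x m) ^+ 2)
  <= ((\sum_(j < k) a (m + j)%N) * (rho + 2 * b)) ^+ 2.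
Proof.
elim: k => [|k IH] hN.
  rewrite big_ord0 mul0r expr0n/=.
  under eq_traj_expect do rewrite addn0 subrr norm2_0 expr0n.
  by rewrite traj_expect_cst.
have r2b : 0 <= rho + 2 * b by rewrite addr_ge0// mulr_ge0.
rewrite big_ord_recr/= mulrDl.
apply: (@le_trans _ _ (E n (fun x => (norm2 (theta x (m + k)%N - theta x m) +
   (a (m + k)%N * rho + a (m + k)%N * 2 * N x (m + k)%N)) ^+ 2))).
  apply: traj_expect_le => // x; rewrite ler_pXn2r ?nnegrE ?norm2_ge0//; last first.
    by rewrite !addr_ge0 ?norm2_ge0// !mulr_ge0// norm2_ge0.
  rewrite addnS thetaS addrAC (le_trans (norm2D _ _))// lerD2l norm2Z ger0_norm//.
  by rewrite -mulrA -mulrDr ler_wpM2l.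
apply: traj_expect_minkowski => //.
- by rewrite mulr_ge0// sumr_ge0.
- by rewrite mulr_ge0.
- by apply: IH => j jk; apply: hN; rewrite addnS leqW.
- rewrite (_ : a (m + k)%N * (rho + 2 * b) = a (m + k)%N * rho + a (m + k)%N * 2 * b); last by ring.
  apply: rms_affine => //; rewrite ?mulr_ge0//.
  by apply: hN; rewrite addnS.
Qed.

(** With the iterate frozen at time m, the state [tau] steps later is nearly stationary. The
    stationary mean of the drift is nonpositive by [h_monotone], so only the l^1 distance to [pi]
    times the size of the drift remains. *)
Lemma drift_mixed_frozen m : E m (fun x => N x m ^+ 2) <= b ^+ 2 ->
  E (m + tau).+1 (fun x => dotv (theta x m - theta_star)
     (h (theta x m) (x (m + tau)%N) (x (m + tau).+1))) <= 2 * eps * M.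
Proof.
move=> hN.
rewrite (traj_expect_transition P mu m tau
  (fun x s s' => dotv (theta x m - theta_star) (h (theta x m) s s'))); last first.
  by move=> s s' x y xy; rewrite (theta_adapted m x y xy).
pose G x := (rho + N x m) * (rho + 2 * N x m).
apply: (@le_trans _ _ (E m (fun x => 2 * eps * G x))); last first.
  have eps0 (x : S) : 0 <= 2 * eps by apply: le_trans (mixing x); rewrite sumr_ge0.
  have [s _] := prob_vec_inhabited mu mu_prob.
  by rewrite traj_expectZ ler_wpM2l ?(eps0 s)// expect_product_le.
apply: traj_expect_le => // x.
set f := fun s => \sum_s' P s s' * dotv (theta x m - theta_star) (h (theta x m) s s').
have G0 : 0 <= G x by rewrite /G mulr_ge0 ?addr_ge0 ?mulr_ge0 ?norm2_ge0.
have f_le s : `|f s| <= G x.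
  rewrite (le_trans (ler_norm_sum _ _ _))// -[leRHS]mul1r -(P_stoch.2 s) mulr_suml.
  apply: ler_sum => s' _; rewrite normrM ger0_norm ?P_stoch.1//.
  by rewrite ler_wpM2l ?P_stoch.1// normr_dotv_noise_le.
(* The law of the state is split into its deviation from [pi], bounded through [mixing], and [pi]
   itself, handled by monotonicity. *)
have -> : \sum_s Pow P tau (x m) s * f s =
    \sum_s (Pow P tau (x m) s - pi s) * f s + \sum_s pi s * f s.
  by rewrite -big_split/=; apply: eq_bigr => s _; rewrite -mulrDl subrK.
rewrite -[leRHS]addr0 lerD ?h_monotone//.
apply: (@le_trans _ _ (\sum_s `|Pow P tau (x m) s - pi s| * G x)).
  by apply: ler_sum => s _; rewrite (le_trans (ler_norm _))// normrM ler_wpM2l.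
by rewrite -mulr_suml ler_wpM2r.
Qed.

Lemma drift_mixed m :
  (forall j, (j <= m + tau)%N -> E j (fun x => N x j ^+ 2) <= b ^+ 2) ->
  E (m + tau).+1 (fun x => dotv (theta x (m + tau)%N - theta_star)
     (h (theta x (m + tau)%N) (x (m + tau)%N) (x (m + tau).+1)))
  <= (rho + 2 * b) * (3 * rho + 4 * b) * (\sum_(j < tau) a (m + j)%N) + 2 * eps * M.
Proof.
move=> hN; set i := (m + tau)%N.
have hN' j : (j <= i)%N -> E i.+1 (fun x => N x j ^+ 2) <= b ^+ 2.
  move=> ji; rewrite (traj_expect_widen P mu P_stoch (leqW ji)) ?hN//.
  by move=> x y xy; rewrite (theta_adapted j x y xy).
pose D x := norm2 (theta x i - theta x m).
apply: (@le_trans _ _ (E i.+1 (fun x =>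
    D x * ((3 * rho + 2 * N x i) + 2 * N x m) +
    dotv (theta x m - theta_star) (h (theta x m) (x i) (x i.+1))))).
  apply: traj_expect_le => // x.
  set hi := h (theta x i) _ _; set hm := h (theta x m) _ _.
  (* The iterate is exchanged in the first slot and then in the second. The growth and Lipschitz
     bounds make the two corrections at most D (rho + 2 N_i) and 2 D (rho + N_m), which add up to D
     (3 rho + 2 N_i + 2 N_m). *)
  have -> : dotv (theta x i - theta_star) hi = dotv (theta x i - theta x m) hi
      + dotv (theta x m - theta_star) (hi - hm) + dotv (theta x m - theta_star) hm.
    by rewrite -addrA -dotvDr subrK -dotvDl addrA subrK.
  rewrite lerD2r.
  have h1 : dotv (theta x i - theta x m) hi <= D x * (rho + 2 * N x i).
    by rewrite (le_trans (dotv_le _ _))// ler_wpM2l ?norm2_ge0//; exact: h_growth.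
  have h2 : dotv (theta x m - theta_star) (hi - hm) <= (rho + N x m) * (2 * D x).
    rewrite (le_trans (dotv_le _ _))// ler_pM ?norm2_ge0//.
      by rewrite (le_trans (norm2B _ _))// addrC lerD2r.
    exact: h_lipschitz.
  apply: (le_trans (lerD h1 h2)); rewrite le_eqVlt; apply/orP; left; apply/eqP; ring.
rewrite traj_expectD lerD//; last first.
  by apply: drift_mixed_frozen; apply: hN; rewrite leq_addr.
rewrite (_ : _ * _ * _ = ((\sum_(j < tau) a (m + j)%N) * (rho + 2 * b)) *
   ((3 * rho + 2 * b) + 2 * b)); last by ring.
have rho3 : 0 <= 3 * rho by rewrite mulr_ge0.
apply: traj_expect_cauchy_schwarz => //.
- by rewrite mulr_ge0 ?sumr_ge0// addr_ge0// mulr_ge0.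
- by rewrite !addr_ge0 ?mulr_ge0.
- by apply: rms_increment => j ji; apply: hN'; exact: ltnW.
- apply: traj_expect_minkowski => //; rewrite ?addr_ge0 ?mulr_ge0//.
    by apply: rms_affine => //; exact: hN'.
  have := rms_affine i.+1 (fun x => N x m) b 0 2 b_ge0 (lexx _) (ler0n _ _) (hN' m (leq_addr _ _)).
  by under eq_traj_expect do rewrite add0r; rewrite add0r.
Qed.

(** Bound on the mean drift at step i: crude before [tau], mixed from [tau] on. *)
Let z i := if (i < tau)%N then M
  else (rho + 2 * b) * (3 * rho + 4 * b) * (\sum_(j < tau) a (i - tau + j)%N) + 2 * eps * M.

(** Expansion of the square at each update gives twice the step size times the drift plus the
    squared length of the update. The start at 0 contributes |theta_star|^2 <= rho^2. *)
Lemma sq_dist_le t :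
  (forall j, (j < t)%N -> E j (fun x => N x j ^+ 2) <= b ^+ 2) ->
  E t (fun x => norm2 (theta x t - theta_star) ^+ 2) <=
  rho ^+ 2 + \sum_(i < t) (2 * (a i * z i) + a i ^+ 2 * (rho + 2 * b) ^+ 2).
Proof.
elim: t => [|t IH] hN.
  rewrite big_ord0 addr0; under eq_traj_expect do rewrite theta0 sub0r norm2N.
  by rewrite traj_expect_cst// ler_pXn2r ?nnegrE ?norm2_ge0.
have hNt : E t.+1 (fun x => N x t ^+ 2) <= b ^+ 2.
  rewrite (traj_expect_widen P mu P_stoch (leqnSn t)) ?hN//.
  by move=> x y xy; rewrite (theta_adapted t x y xy).
pose H x := h (theta x t) (x t) (x t.+1).
have -> : E t.+1 (fun x => norm2 (theta x t.+1 - theta_star) ^+ 2) =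
    E t.+1 (fun x => norm2 (theta x t - theta_star) ^+ 2 +
      (2 * a t * dotv (theta x t - theta_star) (H x) + a t ^+ 2 * norm2 (H x) ^+ 2)).
  apply: eq_traj_expect => x; rewrite !sqr_norm2 thetaS addrAC -/(H x).
  move: (theta x t - theta_star) (H x) => u v.
  by rewrite dotvDl !dotvDr !dotvZl !dotvZr (dotvC v u); ring.
rewrite traj_expectD traj_expectD !traj_expectZ big_ord_recr/= [leRHS]addrA lerD//.
  rewrite (traj_expect_widen P mu P_stoch (leqnSn t)).
    by apply: IH => j jt; apply: hN; exact: ltnW.
  by move=> x y xy; rewrite (theta_adapted t x y xy).
rewrite -mulrA lerD ?ler_wpM2l ?sqr_ge0//; last first.
  apply: (@le_trans _ _ (E t.+1 (fun x => (rho + 2 * N x t) ^+ 2))).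
    apply: traj_expect_le => // x; rewrite ler_pXn2r ?nnegrE ?norm2_ge0//.
      exact: h_growth.
    by rewrite addr_ge0// mulr_ge0// norm2_ge0.
  exact: rms_affine.
rewrite /z; case: ltnP => ttau; first exact: drift_crude.
have [m tE] : exists m, t = (m + tau)%N by exists (t - tau)%N; rewrite subnK.
rewrite {}/H tE addnK; apply: drift_mixed => j; rewrite -tE => jt.
exact: hN.
Qed.

(** Separates the accumulated error into the steps before mixing, the mixing bias, and the terms
    quadratic in the step sizes, so that only three sums of step sizes remain to be estimated. *)
Lemma sq_dist_le_sums t :
  (forall j, (j < t)%N -> E j (fun x => N x j ^+ 2) <= b ^+ 2) ->
  E t (fun x => norm2 (theta x t - theta_star) ^+ 2) <=
  rho ^+ 2 + 2 * M * (\sum_(i < tau) a i) + 4 * eps * M * (\sum_(i < t) a i)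
  + (2 * (rho + 2 * b) * (3 * rho + 4 * b) * tau%:R + (rho + 2 * b) ^+ 2)
    * (\sum_(i < t) a i ^+ 2).
Proof.
move=> hN; apply: (le_trans (sq_dist_le t hN)).
have [s _] := prob_vec_inhabited mu mu_prob.
have eps0 : 0 <= eps.
  have : 0 <= 2 * eps by apply: le_trans (mixing s); rewrite sumr_ge0.
  lra.
have r2b : 0 <= rho + 2 * b by rewrite addr_ge0// mulr_ge0.
have r3b : 0 <= 3 * rho + 4 * b by rewrite addr_ge0// mulr_ge0.
have M0 : 0 <= M by rewrite /M mulr_ge0// addr_ge0.
set K := 2 * (rho + 2 * b) * (3 * rho + 4 * b).
have K0 : 0 <= K by rewrite /K !mulr_ge0.
(* The [eps] term arises only for i >= tau but is charged to every i, which avoids a truncated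
   sum. *)
apply: (@le_trans _ _ (rho ^+ 2 + \sum_(i < t) (
   2 * M * (if (i < tau)%N then a i else 0) + 4 * eps * M * a i +
   K * (if (tau <= i)%N then a i * \sum_(j < tau) a (i - tau + j)%N else 0) +
   (rho + 2 * b) ^+ 2 * a i ^+ 2))).
  rewrite lerD2l; apply: ler_sum => i _; rewrite mulrC [X in _ + X]mulrC lerD2r.
  have e0 : 0 <= eps * M * a i by rewrite mulr_ge0// mulr_ge0.
  rewrite /z /K; case: ltnP => h_i; rewrite ?mulr0 ?addr0 ?add0r; lra.
rewrite !big_split/= -!mulr_sumr.
have h1 := ler_wpM2l (mulr_ge0 (ler0n R 2) M0) (ler_sum_head a a_ge0 t tau).
have h2 := ler_wpM2l K0 (sum_window_le a t tau).
lra.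
Qed.

End Step.
End StochasticApproximation.

(** * Step-size and mixing-time estimates *)

Section Estimates.
Context {R : realType}.

(** This is ln u <= u - 1 at u = 1/x. *)
Lemma ln_ge_1_sub_inv (x : R) : 0 < x -> 1 - x^-1 <= ln x.
Proof.
move=> x0; rewrite -[ln x]opprK -lnV ?posrE// lerNr opprB.
have := @le_ln1Dx R (x^-1 - 1); rewrite addrCA subrr addr0; apply.
by rewrite ltrBDr addNr invr_gt0.
Qed.

(* [e = (exp (1/6))^6 <= (6/5)^6 < 3] *)
Lemma ln3_ge1 : 1 <= ln (3 : R).
Proof.
have h : 1 - (6 / 5)^-1 <= ln (6 / 5 : R) by apply: ln_ge_1_sub_inv; lra.
have h6 : ln ((6 / 5 : R) ^+ 6) <= ln 3.
  rewrite ler_ln ?posrE; [lra|by rewrite exprn_gt0//; lra|by []].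
move: h6; rewrite lnXn; last by lra.
rewrite -[_ *+ 6]mulr_natl => h6.
have e : (6 / 5 : R)^-1 = 5 / 6 by rewrite invf_div.
rewrite e in h; lra.
Qed.

Lemma ln2_ge_half : 2^-1 <= ln (2 : R).
Proof. by have := @ln_ge_1_sub_inv 2; move/(_ (ltr0n _ _)); lra. Qed.

Lemma ln_step (n : nat) : (n%:R + 4)^-1 <= ln (n%:R + 4 : R) - ln (n%:R + 3).
Proof.
have n0 : (0 : R) <= n%:R by [].
have n3 : (0 : R) < n%:R + 3 by lra.
have n4 : (0 : R) < n%:R + 4 by lra.
rewrite -ln_div ?posrE//.
apply: le_trans (ln_ge_1_sub_inv _ (divr_gt0 n4 n3)).
rewrite invf_div le_eqVlt; apply/orP; left; apply/eqP; field; lra.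
Qed.

Lemma ln_shift_ge1 (n : nat) : 1 <= ln (n%:R + 3 : R).
Proof.
apply: (le_trans ln3_ge1); have n0 : (0 : R) <= n%:R by [].
by rewrite ler_ln ?posrE; lra.
Qed.

(** Telescoping: 1 / sqrt(n+1) <= 2 (sqrt(n+1) - sqrt n). With q^2 - p^2 = 1 this amounts to (q -
    p)^2 >= 0. *)
Lemma sum_inv_sqrt_le (n : nat) :
  \sum_(i < n) (Num.sqrt (i%:R + 1 : R))^-1 <= 2 * Num.sqrt n%:R.
Proof.
elim: n => [|n IH]; first by rewrite big_ord0 sqrtr0 mulr0.
rewrite big_ord_recr/=; apply: (le_trans (lerD IH (lexx _))).
have n0 : (0 : R) <= n%:R by [].
have := sqr_sqrtr n0; have := @sqr_sqrtr R (n%:R + 1).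
have -> : n.+1%:R = n%:R + 1 :> R by rewrite natr1.
move/(_ (addr_ge0 n0 ler01)).
have : 0 < Num.sqrt (n%:R + 1 : R) by rewrite sqrtr_gt0; lra.
move: (Num.sqrt (n%:R + 1)) (Num.sqrt n%:R) => q p q0 qE pE.
rewrite -(ler_pM2r q0) mulrDl mulVf ?gt_eqF//.
have := sqr_ge0 (q - p); nra.
Qed.

(* [1/ln] is the telescoping primitive: [1/ln(n+3) - 1/ln(n+4) >= 1/((n+4) ln^2(n+4))]. *)
Lemma sum_inv_ln_sq_le (n : nat) :
  \sum_(i < n) ((i%:R + 1) * ln (i%:R + 3 : R) ^+ 2)^-1 <= 3.
Proof.
apply: (@le_trans _ _ (\sum_(i < n.+1) ((i%:R + 1) * ln (i%:R + 3 : R) ^+ 2)^-1)).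
  apply: (ler_sum_widen (fun i => ((i%:R + 1) * ln (i%:R + 3 : R) ^+ 2)^-1)) => // i.
  by rewrite invr_ge0 mulr_ge0 ?sqr_ge0// addr_ge0.
(* The strengthened bound for n+1 terms. The base case is u^2 + 2u <= 3 with u = 1 / ln 3 <= 1, and
   the factor 2 pays for having n+2 instead of n+4 in the summand. *)
apply: (@le_trans _ _ (3 - 2 / ln (n%:R + 3))); last first.
  by rewrite gerBl divr_ge0// (le_trans _ (ln_shift_ge1 n)).
elim: n => [|n IH].
  rewrite big_ord_recl big_ord0 addr0/= !add0r mul1r.
  have := ln3_ge1; move: (ln 3) => l l1.
  have u0 : 0 <= l^-1 by rewrite invr_ge0; lra.
  have u1 : l^-1 <= 1 by rewrite invf_le1//; lra.
  rewrite expr2 invfM; nra.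
rewrite big_ord_recr/=; apply: (le_trans (lerD IH (lexx _))).
have n0 : (0 : R) <= n%:R by [].
have := ln_step n; have := ln_shift_ge1 n.
have -> : n.+1%:R + 3 = n%:R + 4 :> R by rewrite -natr1; ring.
have -> : n.+1%:R + 1 = n%:R + 2 :> R by rewrite -natr1; ring.
move: (ln (n%:R + 3)) (ln (n%:R + 4)) => x y x1 xy.
have n4 : (0 : R) < (n%:R + 4)^-1 by rewrite invr_gt0; lra.
have y0 : 0 < y by lra.
have x0 : 0 < x by lra.
suff : ((n%:R + 2) * y ^+ 2)^-1 <= 2 / x - 2 / y by lra.
have -> : 2 / x - 2 / y = 2 * (y - x) / (x * y) by field; rewrite !gt_eqF.
apply: (@le_trans _ _ (2 * (n%:R + 4)^-1 / (y * y))).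
  rewrite -expr2 invfM ler_wpM2r ?invr_ge0 ?sqr_ge0//.
  have n2 : (0 : R) < n%:R + 2 by lra.
  have n4' : (0 : R) < n%:R + 4 by lra.
  by rewrite ler_pdivlMr// mulrC ler_pdivrMr//; lra.
apply: ler_pM; rewrite ?invr_ge0 ?mulr_ge0//; try lra.
by rewrite lef_pV2 ?posrE ?mulr_gt0// ler_pM2r//; lra.
Qed.

(** The witness is the integer part of L. The summand 1 in L absorbs the rounding: L < tau + 1 gives
    ln(C sqrt T) / ln(1/alpha) < tau, which is the decay estimate after taking logarithms. *)
Lemma mixing_time_exists (C alpha : R) (T : nat) : 0 < C -> 0 < alpha < 1 -> (0 < T)%N ->
  let L := ln (C * Num.sqrt T%:R) / ln (alpha^-1) + 1 in 0 <= L ->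
  exists2 tau : nat, tau%:R <= L & C * alpha ^+ tau <= (Num.sqrt T%:R)^-1.
Proof.
move=> C0 /andP[al0 al1] T0 L L0.
have /andP[tL Lt] := truncn_itv L0.
exists (Num.truncn L) => //; set tau := Num.truncn L in tL Lt *.
have s0 : 0 < Num.sqrt T%:R :> R by rewrite sqrtr_gt0 ltr0n.
have lna : 0 < ln alpha^-1 by rewrite ln_gt0// invf_gt1.
rewrite -[leRHS]mul1r ler_pdivlMr// mulrAC -ler_pdivlMr ?exprn_gt0// mul1r -exprVn.
rewrite -ler_ln ?posrE ?mulr_gt0 ?exprn_gt0 ?invr_gt0//.
rewrite lnXn ?invr_gt0// -[ln _ *+ _]mulr_natl -ler_pdivrMr//.
by move: Lt; rewrite -natr1 /L ltrD2r => /ltW.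
Qed.

Lemma cube_le_of_powR (L y : R) : 0 <= L -> L `^ (3 / 4) <= y -> L ^+ 3 <= y ^+ 4.
Proof.
move=> L0 hy.
have -> : L ^+ 3 = (L `^ (3 / 4)) ^+ 4.
  by rewrite -!powR_mulrn ?powR_ge0// -powRrM; congr (_ `^ _); lra.
by rewrite lerXn2r// nnegrE ?powR_ge0// (le_trans _ hy)// powR_ge0.
Qed.

(** Otherwise L^3 > 64 y^6 >= 16 y^4, using y^2 >= 1/4, against L^3 <= y^4. It makes the mixing time
    quadratic in log T. *)
Lemma le_4sqr_of_powR (L y : R) : 0 <= L -> 2^-1 <= y -> L `^ (3 / 4) <= y -> L <= 4 * y ^+ 2.
Proof.
move=> L0 hy /(cube_le_of_powR _ _ L0) h.
rewrite leNgt; apply/negP => hL.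
have y0 : 0 < y by lra.
have y2 : 4^-1 <= y ^+ 2 by rewrite expr2; nra.
have : (4 * y ^+ 2) ^+ 3 < L ^+ 3 by rewrite ltr_pXn2r// nnegrE mulr_ge0// sqr_ge0.
have -> : (4 * y ^+ 2) ^+ 3 = 64 * y ^+ 2 * y ^+ 4 by ring.
have y4 : 0 < y ^+ 4 by exact: exprn_gt0.
nra.
Qed.

End Estimates.

(** * The constant [omega_c] *)

Section Omega.
Context {R : realType}.
Implicit Types c x : R.

(** The larger root of c^2 - 60c - 402, at which the denominators in [omega_c] vanish; the other
    root is 60 - [c_crit]. *)
Definition c_crit : R := 30 + Num.sqrt 1302.

Lemma c_crit_root : c_crit ^+ 2 = 60 * c_crit + 402.
Proof.
rewrite /c_crit; have := sqr_sqrtr (ler0n R 1302).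
move: (Num.sqrt _) => s sE; rewrite sqrrD sE; lra.
Qed.

Lemma c_crit_gt66 : 66 < c_crit.
Proof.
have : 30 <= c_crit by rewrite /c_crit lerDl; exact: sqrtr_ge0.
have := c_crit_root; move: c_crit => k kE k30.
by rewrite ltNge; apply/negP => h; nra.
Qed.

Lemma c_crit_lt67 : c_crit < 67.
Proof.
have := c_crit_root; move: c_crit => k kE.
by rewrite ltNge; apply/negP => h; nra.
Qed.

Lemma omega_den_factor c : c ^+ 2 - 60 * c - 402 = (c - c_crit) * (c + c_crit - 60).
Proof.
have := c_crit_root; move: c_crit => k kE.
have -> : (c - k) * (c + k - 60) = c ^+ 2 - 60 * c + 60 * k - k ^+ 2 by ring.
rewrite kE; ring.
Qed.

Lemma omega_den_gt0 c : c_crit < c -> 0 < c ^+ 2 - 60 * c - 402.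
Proof.
rewrite omega_den_factor; have := c_crit_gt66; move: c_crit => k k66 kc.
by apply: mulr_gt0; lra.
Qed.

Lemma omega_frac_ge1 c : c_crit < c ->
  1 <= (2 * c ^+ 2 + 72 * c + 417) / (2 * c ^+ 2 - 120 * c - 804).
Proof.
move=> hc; have A0 := omega_den_gt0 _ hc; have s := c_crit_gt66.
rewrite ler_pdivlMr; lra.
Qed.

Lemma omega_c_ge1 c : c_crit < c -> 1 <= omega_c c.
Proof.
move=> hc; rewrite /omega_c (le_trans (omega_frac_ge1 _ hc))// lerDl sqrtr_ge0//.
Qed.

(** Multiplied by c^2, the equation becomes A w^2 = B w + (54c + 110) with A = c^2 - 60c - 402 and B
    = 2c^2 + 72c + 417, and [omega_c] is its root with the plus sign. *)
Lemma omega_c_root c : c_crit < c ->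
  omega_c c ^+ 2 - 2 * omega_c c =
  c^-1 * (60 * omega_c c ^+ 2 + 72 * omega_c c + 54)
  + c^-1 ^+ 2 * (402 * omega_c c ^+ 2 + 417 * omega_c c + 110).
Proof.
move=> hc; have A0 := omega_den_gt0 _ hc; have s := c_crit_gt66.
have cp : 0 < c by lra.
rewrite /omega_c.
have -> : 2 * c ^+ 2 - 120 * c - 804 = 2 * (c ^+ 2 - 60 * c - 402) by ring.
set A := c ^+ 2 - 60 * c - 402 in A0 *.
set B := 2 * c ^+ 2 + 72 * c + 417.
set D := 4 * c ^+ 4 + _ - _ - _ - _.
(* The quartic under the square root is the discriminant of this quadratic. *)
have DE : D = B ^+ 2 + 4 * A * (54 * c + 110) by rewrite /D /B /A; ring.
have B0 : 0 < B by rewrite /B; have := sqr_ge0 c; lra.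
have D0 : 0 <= D / (4 * A ^+ 2).
  apply: divr_ge0; last by rewrite mulr_ge0 ?sqr_ge0.
  rewrite DE; apply: addr_ge0; first exact: sqr_ge0.
  by apply: mulr_ge0; lra.
have := sqr_sqrtr D0; move: (Num.sqrt _) => q qE.
have eqn : A * (B / (2 * A) + q) ^+ 2 = B * (B / (2 * A) + q) + (54 * c + 110).
  apply/eqP; rewrite -subr_eq0; apply/eqP.
  transitivity (A * q ^+ 2 - B ^+ 2 / (4 * A) - (54 * c + 110)); first by field; rewrite gt_eqF.
  rewrite qE DE; field; rewrite gt_eqF//.
move: (B / (2 * A) + q) eqn => w eqn.
have : c ^+ 2 * (w ^+ 2 - 2 * w) = c * (60 * w ^+ 2 + 72 * w + 54)
   + (402 * w ^+ 2 + 417 * w + 110) by move: eqn; rewrite /A /B; lra.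
move=> e; apply: (mulfI (x := c ^+ 2)); first by rewrite expf_neq0// gt_eqF.
rewrite e; field; rewrite gt_eqF//.
Qed.

Lemma ler_frac (k m x y : R) : 0 < x -> 0 < y -> k * y <= m * x -> k / x <= m / y.
Proof. by move=> x0 y0 h; rewrite ler_pdivrMr// mulrAC ler_pdivlMr. Qed.

Lemma frac_sqr_bound (k m c a : R) : 0 < c -> c ^+ 2 / 2 <= a ->
  0 <= k <= m * c ^+ 3 -> 0 <= k / a ^+ 2 <= 4 * m / c.
Proof.
move=> c0 ca /andP[k0 km].
have c20 : 0 < c ^+ 2 by exact: exprn_gt0.
have a0 : 0 < a by lra.
rewrite divr_ge0 ?sqr_ge0//=; apply: ler_frac => //; first exact: exprn_gt0.
have m0 : 0 <= m by rewrite -(pmulr_lge0 (x := c ^+ 3)) ?(le_trans k0)// exprn_gt0.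
have a2 : (c ^+ 2 / 2) ^+ 2 <= a ^+ 2 by rewrite ler_pXn2r// nnegrE; lra.
have ck : k * c <= m * c ^+ 3 * c by rewrite ler_pM2r.
have ma : m * (c ^+ 2 / 2) ^+ 2 <= m * a ^+ 2 by rewrite ler_wpM2l.
apply: (le_trans ck).
have -> : m * c ^+ 3 * c = 4 * (m * (c ^+ 2 / 2) ^+ 2) by field.
lra.
Qed.

Lemma sqrtr_sub1_bound (q : R) : 0 <= q - 1 -> 0 <= Num.sqrt q - 1 <= q - 1.
Proof.
move=> q1; have q0 : 0 <= q by lra.
have s1 : 1 <= Num.sqrt q by rewrite -[leLHS]sqrtr1 ler_sqrt//; lra.
have := sqr_sqrtr q0; move: (Num.sqrt q) s1 => s s1 sE.
by apply/andP; split; nra.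
Qed.

(** The rational term and the radicand both tend to 1 at rate 1/c: for c >= 1000 they exceed 1 by at
    most 300/c and 984/c, and sqrt q - 1 <= q - 1 for q >= 1. Hence the distance to 2 is below
    2000/c. *)
Lemma cvg_omega_c_pinfty : (omega_c x @[x --> +oo] --> (2 : R)).
Proof.
apply/cvgrPdistC_le => e e0.
near=> c.
have c1 : 1000 <= c by near: c; apply: nbhs_pinfty_ge; exact: num_real.
have ce : 2000 / e <= c by near: c; apply: nbhs_pinfty_ge; exact: num_real.
have ce' : 2000 / c <= e by move: ce; rewrite !ler_pdivrMr//; lra.
apply: le_trans ce'.
set A := c ^+ 2 - 60 * c - 402.
have A0 : c ^+ 2 / 2 <= A by rewrite /A; nra.
have Ap : 0 < A by nra.
rewrite /omega_c.
set q := (X in Num.sqrt X).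
set p := (X in X + Num.sqrt _).
have p1 : 0 <= p - 1 <= 300 / c.
  have -> : p - 1 = (96 * c + 1221 / 2) / A.
    rewrite /p (_ : 2 * c ^+ 2 - 120 * c - 804 = 2 * A); last by rewrite /A; ring.
    rewrite (_ : 2 * c ^+ 2 + _ + _ = 2 * (A + (96 * c + 1221 / 2))); last by rewrite /A; field.
    move: (_ / 2); move: A Ap {A0} => a a0 k; field; exact: lt0r_neq0.
  have k0 : 0 <= 96 * c + 1221 / 2 <= 100 * c by lra.
  move: (_ + _ / 2) k0 => k k0.
  apply/andP; split; first by apply: divr_ge0; lra.
  by apply: (ler_frac _ _ _ _ Ap); nra.
have q1 : 0 <= q - 1 <= 4 * 246 / c.
  pose k := (4 * c ^+ 4 + 504 * c ^+ 3 - (4 * 1417) * c ^+ 2 - (64 * 831) * c - 2991) / 4 - A ^+ 2.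
  have -> : q - 1 = k / A ^+ 2.
    rewrite /q /k -/A; move: (_ - 2991); move: A Ap {A0 k} => a a0 k; field; exact: lt0r_neq0.
  have c2 : 1000 * c <= c ^+ 2 by nra.
  have c3 : 1000 * c ^+ 2 <= c ^+ 3 by rewrite exprS; nra.
  have k0 : 0 <= k <= 246 * c ^+ 3.
    have -> : k = 246 * c ^+ 3 - 4213 * c ^+ 2 - (64 * 831 / 4 + 120 * 402) * c - (402 ^+ 2 + 2991 / 4) by rewrite /k /A; field.
    lra.
  have cp : 0 < c by lra.
  exact: (frac_sqr_bound _ _ _ _ cp A0 k0).
clearbody p q.
have /andP[q1l q1u] := q1; have /andP[s1l s1u] := sqrtr_sub1_bound _ q1l.
move: (Num.sqrt q) s1l s1u => sq s1l s1u.
clear A A0 Ap ce q1l q1.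
have cp : 0 <= c^-1 by apply: ltW; rewrite invr_gt0; lra.
move: c^-1 cp p1 q1u => v v0 p1 q1u.
rewrite ger0_norm; last by lra.
lra.
Unshelve. all: by end_near.
Qed.

(** The rational term alone diverges: its numerator stays bounded below while its denominator has
    the factor c - [c_crit], made smaller than 1 / (|M| + 1). *)
Lemma cvg_omega_c_right : (omega_c x @[x --> c_crit^'+] --> +oo).
Proof.
apply/cvgryPge => M.
near=> c.
have hc : c_crit < c by near: c; exact: nbhs_right_gt.
have c1 : c < c_crit + 1 by near: c; apply: nbhs_right_lt; lra.
have cM : c < c_crit + (`|M| + 1)^-1.
  by near: c; apply: nbhs_right_lt; rewrite ltrDl invr_gt0 ltr_wpDl.
have k66 := c_crit_gt66; have k67 := c_crit_lt67.
have A0 := omega_den_gt0 _ hc.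
apply: (@le_trans _ _ ((2 * c ^+ 2 + 72 * c + 417) / (2 * c ^+ 2 - 120 * c - 804))); last first.
  by rewrite lerDl; exact: sqrtr_ge0.
have -> : 2 * c ^+ 2 - 120 * c - 804 = 2 * (c ^+ 2 - 60 * c - 402) by ring.
rewrite ler_pdivlMr; last by rewrite mulr_gt0.
have M1 := ler_norm M.
have M0 := normr_ge0 M.
apply: (@le_trans _ _ (`|M| * (2 * (c ^+ 2 - 60 * c - 402)))).
  by rewrite ler_wpM2r// mulr_ge0// ltW.
rewrite omega_den_factor; move: `|M| M0 cM {M1} => m m0 cM.
have cm : (c - c_crit) * (m + 1) <= 1.
  by rewrite -ler_pdivlMr ?mul1r; lra.
have : (c - c_crit) * m <= 1 by nra.
nra.
Unshelve. all: by end_near.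
Qed.

End Omega.

(** * Temporal-difference updates *)

Section TemporalDifference.
Context {R : realType} {S : finType} {d : nat}.
Variables (P : S -> S -> R) (pi : S -> R) (gamma r_inf phi_inf : R).
Variables (r : S -> S -> R) (phi : S -> 'cV[R]_d) (theta_star : 'cV[R]_d).
Hypotheses (P_stoch : stochastic P) (pi_stat : stationary P pi).
Hypothesis gamma01 : 0 < gamma < 1.
Hypothesis r_bound : forall s s', 0 <= r s s' <= r_inf.
Hypothesis phi_bound : forall s, norm2 (phi s) <= phi_inf.
Hypothesis fixpoint : td_gbar P pi gamma r phi theta_star = 0.

Local Notation g := (td_g gamma r phi).

Lemma td_g_growth th s s' : norm2 (g th s s') <= (r_inf + 2 * phi_inf * norm2 th) * phi_inf.
Proof.
have /andP[g0 g1] := gamma01; have /andP[r0 r1] := r_bound s s'.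
rewrite /td_g norm2Z; apply: ler_pM; rewrite ?norm2_ge0//.
have N0 := norm2_ge0 th.
have h u : `|dotv (phi u) th| <= phi_inf * norm2 th.
  by rewrite (le_trans (normr_dotv_le _ _))// ler_wpM2r.
have h1 : `|gamma * dotv (phi s') th| <= phi_inf * norm2 th.
  rewrite normrM gtr0_norm// (le_trans _ (h s'))// ler_piMl// ltW//.
have := h s; move: h1; rewrite !ler_norml => /andP[? ?] /andP[? ?].
by apply/andP; split; lra.
Qed.

(** The update is affine in the parameter, so the reward cancels. *)
Lemma td_g_sub th th' s s' : g th s s' - g th' s s' =
  (gamma * dotv (phi s') (th - th') - dotv (phi s) (th - th')) *: phi s.
Proof. by rewrite /td_g -scalerBl; congr (_ *: _); rewrite !dotvDr !dotvNr; ring. Qed.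

Lemma td_g_lipschitz th th' s s' :
  norm2 (g th s s' - g th' s s') <= 2 * phi_inf ^+ 2 * norm2 (th - th').
Proof.
have /andP[g0 g1] := gamma01.
rewrite td_g_sub norm2Z; move: (th - th') => w.
have -> : 2 * phi_inf ^+ 2 * norm2 w = (2 * phi_inf * norm2 w) * phi_inf by ring.
apply: ler_pM; rewrite ?norm2_ge0//.
have N0 := norm2_ge0 w.
have h u : `|dotv (phi u) w| <= phi_inf * norm2 w.
  by rewrite (le_trans (normr_dotv_le _ _))// ler_wpM2r.
have h1 : `|gamma * dotv (phi s') w| <= phi_inf * norm2 w.
  rewrite normrM gtr0_norm// (le_trans _ (h s'))// ler_piMl// ltW//.
have := h s; move: h1; rewrite !ler_norml => /andP[? ?] /andP[? ?].
by apply/andP; split; lra.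
Qed.

(** Subtracting the vanishing mean update at [theta_star] leaves the mean of (gamma f(s') - f(s))
    f(s), with f the feature values of th - [theta_star]. This is nonpositive because f(s) and f(s')
    have the same second moment under stationarity. *)
Lemma td_g_monotone th :
  \sum_s pi s * \sum_s' P s s' * dotv (th - theta_star) (g th s s') <= 0.
Proof.
have /andP[g0 g1] := gamma01; have [[pi0 pi1] piP] := pi_stat.
set w := th - theta_star.
have star0 : \sum_s pi s * \sum_s' P s s' * dotv w (g theta_star s s') = 0.
  transitivity (dotv w (td_gbar P pi gamma r phi theta_star)); last by rewrite fixpoint dotv0r.
  rewrite dotv_sumr; apply: eq_bigr => s _; rewrite dotv_sumr mulr_sumr.
  by apply: eq_bigr => s' _; rewrite dotvZr mulrA.
pose f s := dotv (phi s) w.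
have -> : \sum_s pi s * \sum_s' P s s' * dotv w (g th s s') =
    \sum_s pi s * \sum_s' P s s' * ((gamma * f s' - f s) * f s).
  rewrite -[LHS]subr0 -[X in _ - X]star0 -sumrB; apply: eq_bigr => s _.
  rewrite -mulrBr -sumrB; congr (_ * _); apply: eq_bigr => s' _.
  by rewrite -mulrBr -dotvNr -dotvDr td_g_sub dotvZr (dotvC w).
(* By AM-GM and gamma < 1, gamma f(s') f(s) <= (f(s')^2 + f(s)^2) / 2; what remains is half a
   difference of squares. *)
apply: (@le_trans _ _ (\sum_s pi s * \sum_s' P s s' *
    (2^-1 * (f s' ^+ 2) - 2^-1 * f s ^+ 2))).
  apply: ler_sum => s _; rewrite ler_wpM2l//; apply: ler_sum => s' _.
  rewrite ler_wpM2l ?P_stoch.1//.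
  have h1 := sqr_ge0 (f s - f s'); have h2 := sqr_ge0 (f s + f s').
  have h3 := sqr_ge0 (f s); have h4 := sqr_ge0 (f s').
  have h5 : gamma * (f s' * f s) <= 2^-1 * (f s' ^+ 2 + f s ^+ 2).
    have h6 : f s' * f s <= 2^-1 * (f s' ^+ 2 + f s ^+ 2) by lra.
    have h7 : 0 <= 2^-1 * (f s' ^+ 2 + f s ^+ 2) by lra.
    apply: (le_trans (ler_wpM2l (ltW g0) h6)).
    by rewrite ler_piMl// ltW.
  lra.
(* Summing over s first makes invariance of [pi] applicable to the f(s')^2 part, after which the two
   parts cancel. *)
have -> : \sum_s pi s * \sum_s' P s s' * (2^-1 * f s' ^+ 2 - 2^-1 * f s ^+ 2) =
    \sum_s' (\sum_s pi s * P s s') * (2^-1 * f s' ^+ 2) - \sum_s pi s * (2^-1 * f s ^+ 2).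
  under [X in _ = X - _]eq_bigr do rewrite mulr_suml.
  rewrite [X in _ = X - _]exchange_big/= -sumrB; apply: eq_bigr => s _.
  under eq_bigr do rewrite mulrBr.
  rewrite sumrB -mulr_suml P_stoch.2 mul1r mulrBr mulr_sumr; congr (_ - _).
  by apply: eq_bigr => s' _; rewrite mulrA.
under eq_bigr do rewrite piP.
by rewrite subrr.
Qed.

End TemporalDifference.

(** * Step-size sums, the error budget and the induction on time *)

(** Covers the degenerate cases in which the denominator of the step size is 0, since the inverse of
    0 is 0. *)
Lemma td_theta_step0 {R : realType} {S : finType} {d : nat} gamma r phi eta x t :
  (forall i, eta i = 0) -> @td_theta R S d gamma r phi eta x t = 0.
Proof. by move=> eta0; elim: t => //= t ->; rewrite eta0 scale0r addr0. Qed.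

(** The first sum discards the factor ln(i+3) >= 1; the second keeps it, which is what makes the
    squared steps summable uniformly in n. *)
Lemma step_sums_le {R : realType} (c y : R) (a : nat -> R) : 0 < c -> 2^-1 <= y ->
  (forall i, a i = (c * y * ln (i%:R + 3) * Num.sqrt (i%:R + 1))^-1) ->
  (forall n, \sum_(i < n) a i <= (c * y)^-1 * (2 * Num.sqrt n%:R)) /\
  (forall n, \sum_(i < n) a i ^+ 2 <= ((c * y) ^+ 2)^-1 * 3).
Proof.
move=> c0 y2 aE.
have y0 : 0 < y by lra.
have cy : 0 < c * y by exact: mulr_gt0.
have s0 (i : nat) : 0 < Num.sqrt (i%:R + 1 : R) by rewrite sqrtr_gt0 ltr_wpDl.
have l1 (i : nat) := @ln_shift_ge1 R i.
split=> n.
  apply: le_trans (ler_wpM2l _ (sum_inv_sqrt_le n)); last by rewrite invr_ge0 ltW.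
  rewrite mulr_sumr; apply: ler_sum => i _; rewrite aE -invfM.
  have l0 : 0 < ln (i%:R + 3 : R) by apply: lt_le_trans (l1 i).
  rewrite lef_pV2 ?posrE ?mulr_gt0// ler_pM2r// -[leLHS]mulr1 ler_pM2l//.
apply: le_trans (ler_wpM2l _ (sum_inv_ln_sq_le n)); last by rewrite invr_ge0 sqr_ge0.
rewrite mulr_sumr; apply: ler_sum => i _.
rewrite aE exprVn -invfM !exprMn sqr_sqrtr; last by rewrite addr_ge0.
by rewrite -mulrA [X in _ * X]mulrC.
Qed.

(* The choice of [omega_c]: it turns the accumulated error of the recursion into [(omega_c - 1) ^ 2]. *)
Lemma error_budget {R : realType} (c w rho b S1 S2 S3 eps tau : R) : 0 < c -> 0 <= w -> 0 <= rho ->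
  w ^+ 2 - 2 * w = c^-1 * (60 * w ^+ 2 + 72 * w + 54)
    + c^-1 ^+ 2 * (402 * w ^+ 2 + 417 * w + 110) ->
  S1 <= 4 * c^-1 -> eps * S2 <= 4 * c^-1 -> S3 <= 12 * c^-1 ^+ 2 -> tau * S3 <= 12 * c^-1 ^+ 2 ->
  b = w * rho ->
  rho ^+ 2 + 2 * ((rho + b) * (rho + 2 * b)) * S1 + 4 * eps * ((rho + b) * (rho + 2 * b)) * S2
  + (2 * (rho + 2 * b) * (3 * rho + 4 * b) * tau + (rho + 2 * b) ^+ 2) * S3
  <= ((w - 1) * rho) ^+ 2.
Proof.
move=> c0 w0 rho0 wE h1 h2 h3 h4 ->.
have v0 : 0 <= c^-1 by rewrite invr_ge0 ltW.
move: c^-1 v0 wE h1 h2 h3 h4 => v v0 wE h1 h2 h3 h4.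
have p0 : 0 <= rho ^+ 2 by exact: sqr_ge0.
pose M := (1 + w) * (1 + 2 * w); pose K := (1 + 2 * w) * (3 + 4 * w).
have M0 : 0 <= M by rewrite /M mulr_ge0; lra.
have K0 : 0 <= K by rewrite /K mulr_ge0; lra.
have Q0 := sqr_ge0 (1 + 2 * w).
have e1 := ler_wpM2l M0 h1.
have e2 := ler_wpM2l M0 h2.
have e3 := ler_wpM2l Q0 h3.
have e4 := ler_wpM2l K0 h4.
have vw : 0 <= v * w by exact: mulr_ge0.
have vww : 0 <= v * w ^+ 2 by rewrite mulr_ge0// sqr_ge0.
have vv : 0 <= v ^+ 2 by exact: sqr_ge0.
have vvw : 0 <= v ^+ 2 * w by exact: mulr_ge0.
have vvww : 0 <= v ^+ 2 * w ^+ 2 by rewrite mulr_ge0// sqr_ge0.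
(* The error terms are at most v (48w^2 + 72w + 24) + v^2 (240w^2 + 288w + 84), coefficientwise
   below the right-hand side of [wE], and (w - 1)^2 = 1 + (w^2 - 2w). *)
have key : 1 + 2 * (M * S1) + 4 * (M * (eps * S2)) + 2 * (K * (tau * S3)) + (1 + 2 * w) ^+ 2 * S3
    <= (w - 1) ^+ 2.
  rewrite /M /K in e1 e2 e3 e4 *; lra.
have := ler_wpM2r p0 key; rewrite -exprMn.
apply: le_trans; rewrite le_eqVlt; apply/orP; left; apply/eqP; rewrite /M /K; ring.
Qed.

Theorem theorem4p2 (R : realType) (S : finType) (P : S -> S -> R) (pi : S -> R)
  (C alpha gamma r_inf phi_inf : R) (r : S -> S -> R) (d : nat)
  (phi : S -> 'cV[R]_d) (theta_star : 'cV[R]_d) (c : R) (T : nat) :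
  stochastic P -> irreducible P -> aperiodic P -> stationary P pi ->
  0 < C -> 0 < alpha < 1 ->
  (forall (s : S) (t : nat), tv_dist (Pow P t s) pi <= C * alpha ^+ t) ->
  0 < gamma < 1 ->
  (forall s s', 0 <= r s s' <= r_inf) ->
  (forall s, norm2 (phi s) <= phi_inf) ->
  \rank (feat_mx phi) = d ->
  td_gbar P pi gamma r phi theta_star = 0 ->
  30 + Num.sqrt 1302 < c ->
  (0 < T)%N ->
  let L := ln (C * Num.sqrt T%:R) / ln (alpha^-1) + 1 in
  0 <= L ->
  ln T%:R >= Num.max (C * Num.sqrt L) (L `^ (3 / 4)) ->
  let eta := fun t : nat =>
    (c * phi_inf ^+ 2 * ln T%:R * ln (t%:R + 3) * Num.sqrt (t%:R + 1))^-1 in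
  ((forall mu : S -> R, prob_vec mu ->
    forall t : nat, (t <= T)%N ->
      traj_expect mu P t (fun x => norm2 (td_theta gamma r phi eta x t) ^+ 2)
      <= omega_c c ^+ 2 * Num.max (r_inf ^+ 2 / phi_inf ^+ 2) (norm2 theta_star ^+ 2))
  /\ (omega_c x @[x --> +oo] --> (2 : R))
  /\ (omega_c x @[x --> (30 + Num.sqrt (1302 : R))^'+] --> +oo)).
Proof.
move=> P_stoch _ _ pi_stat C0 alpha01 tv gamma01 r_bound phi_bound _ fixpoint c_gt T0 L L0.
rewrite ge_max => /andP[_ hL] eta; split; last first.
  by split; [exact: cvg_omega_c_pinfty|exact: cvg_omega_c_right].
move=> mu mu_prob.
have {}c_gt : c_crit < c by exact: c_gt.
have c0 : 0 < c by apply: lt_trans c_gt; apply: lt_trans c_crit_gt66.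
have w1 := omega_c_ge1 _ c_gt; have wE := omega_c_root _ c_gt.
(* From here on [omega_c] enters only through w >= 1 and its quadratic equation. *)
move: (omega_c c) w1 wE => w w1 wE {c_gt}.
set rho2 := Num.max _ _.
have rho2_ge0 : 0 <= rho2 by rewrite /rho2 le_max sqr_ge0 orbT.
have [s0 _] := prob_vec_inhabited mu mu_prob.
have phi0 : 0 <= phi_inf by exact: le_trans (norm2_ge0 _) (phi_bound s0).
have r0 : 0 <= r_inf by have /andP[h1 h2] := r_bound s0 s0; exact: le_trans h1 h2.
have triv : (forall i, eta i = 0) -> forall t, (t <= T)%N ->
    traj_expect mu P t (fun x => norm2 (td_theta gamma r phi eta x t) ^+ 2) <= w ^+ 2 * rho2.
  move=> eta0 t _.
  under eq_traj_expect do rewrite td_theta_step0// norm2_0 expr0n.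
  by rewrite traj_expect_cst// mulr_ge0 ?sqr_ge0.
(* If phi_inf = 0 or T = 1, all step sizes are 0 and the iterates stay at 0. *)
have [phiE|phi_neq0] := eqVneq phi_inf 0.
  by apply: triv => i; rewrite /eta phiE expr0n/= mulr0 !mul0r invr0.
have [T1|T_neq1] := eqVneq T 1%N.
  by apply: triv => i; rewrite /eta T1 ln1 mulr0 !mul0r invr0.
clear triv.
have phip : 0 < phi_inf by rewrite lt0r phi_neq0.
pose y := ln T%:R : R.
have y2 : 2^-1 <= y.
  apply: (le_trans ln2_ge_half); rewrite /y ler_ln ?posrE ?ltr0n// ler_nat.
  by rewrite ltn_neqAle eq_sym T_neq1.
have y0 : 0 < y by lra.
pose rho := Num.max (r_inf / phi_inf) (norm2 theta_star).
have r_rho : r_inf / phi_inf <= rho by rewrite /rho le_max lexx.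
have star_rho : norm2 theta_star <= rho by rewrite /rho le_max lexx orbT.
have rho0 : 0 <= rho by exact: le_trans (norm2_ge0 _) star_rho.
have rho2E : rho2 = rho ^+ 2.
  rewrite /rho2 -expr_div_n /rho; have n0 := norm2_ge0 theta_star.
  have q0 : 0 <= r_inf / phi_inf by exact: divr_ge0.
  case: (leP (r_inf / phi_inf) (norm2 theta_star)) => h.
    by rewrite max_r// ler_pXn2r.
  by rewrite max_l// ler_pXn2r// ltW.
rewrite rho2E -exprMn; clear rho2 rho2_ge0 rho2E.
have [tau tauL tau_mix] := mixing_time_exists C alpha T C0 alpha01 T0 L0.
(* The lower bound of log T by the 3/4 power of L enters here. *)
have tau4 : tau%:R <= 4 * y ^+ 2 by apply: (le_trans tauL); exact: le_4sqr_of_powR.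
pose eps := (Num.sqrt T%:R)^-1 : R.
have mixing s : \sum_s' `|Pow P tau s s' - pi s'| <= 2 * eps.
  have := le_trans (tv s tau) tau_mix; rewrite /tv_dist -/eps; lra.
pose f2 := phi_inf ^+ 2.
have f2p : 0 < f2 by exact: exprn_gt0.
(* Moving the factor phi_inf^2 from the update into the step size gives the growth and Lipschitz
   constants [rho] and 2 of the abstract recursion. *)
pose h th s s' := f2^-1 *: td_g gamma r phi th s s'.
pose a i := eta i * f2.
have aE i : a i = (c * y * ln (i%:R + 3) * Num.sqrt (i%:R + 1))^-1.
  rewrite /a /eta -/f2 -/y.
  have -> : c * f2 * y * ln (i%:R + 3) * Num.sqrt (i%:R + 1) =
    (c * y * ln (i%:R + 3) * Num.sqrt (i%:R + 1)) * f2 by ring.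
  by rewrite invfM mulfVK// gt_eqF.
have [sum1 sum2] := step_sums_le c y a c0 y2 aE.
have a_ge0 i : 0 <= a i.
  rewrite aE invr_ge0 !mulr_ge0 ?sqrtr_ge0//; try exact: ltW.
  exact: le_trans (ln_shift_ge1 i).
have h_growth th s s' : norm2 (h th s s') <= rho + 2 * norm2 th.
  rewrite /h norm2Z gtr0_norm ?invr_gt0// mulrC ler_pdivrMr//.
  apply: (le_trans (td_g_growth _ _ _ _ _ gamma01 r_bound phi_bound _ _ _)).
  have : r_inf <= rho * phi_inf by rewrite -ler_pdivrMr.
  move/(ler_wpM2r phi0); rewrite /f2; lra.
have h_lip th th' s s' : norm2 (h th s s' - h th' s s') <= 2 * norm2 (th - th').
  rewrite /h -scalerBr norm2Z gtr0_norm ?invr_gt0// mulrC ler_pdivrMr//.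
  apply: (le_trans (td_g_lipschitz _ _ _ _ gamma01 phi_bound _ _ _ _)).
  by rewrite -/f2 mulrAC.
have h_mono th : \sum_s pi s * \sum_s' P s s' * dotv (th - theta_star) (h th s s') <= 0.
  have := td_g_monotone _ _ _ _ _ _ P_stoch pi_stat gamma01 fixpoint th.
  rewrite -(pmulr_rle0 _ (x := f2^-1)) ?invr_gt0// mulr_sumr.
  apply: le_trans; rewrite le_eqVlt; apply/orP; left; apply/eqP.
  apply: eq_bigr => s _; rewrite mulrCA; congr (_ * _); rewrite mulr_sumr.
  by apply: eq_bigr => s' _; rewrite /h dotvZr mulrCA.
pose theta x t := td_theta gamma r phi eta x t.
have thetaS x t : theta x t.+1 = theta x t + a t *: h (theta x t) (x t) (x t.+1).
  by rewrite /theta/= /h /a scalerA mulfK// gt_eqF.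
have w0 : 0 <= w by lra.
have b0 : 0 <= w * rho by exact: mulr_ge0.
(* Strong induction, since the recursion needs the second-moment bound at all earlier times. *)
elim/ltn_ind => t IH tT.
have step := sq_dist_le_sums P mu pi P_stoch mu_prob h theta_star rho h_growth h_lip h_mono
  star_rho a a_ge0 theta (fun=> erefl) thetaS tau eps mixing (w * rho) b0 t
  (fun j jt => IH j jt (leq_trans (ltnW jt) tT)).
have {step} dist : traj_expect mu P t (fun x => norm2 (theta x t - theta_star) ^+ 2)
    <= ((w - 1) * rho) ^+ 2.
  apply: (le_trans step); apply: (error_budget _ _ _ _ _ _ _ _ _ c0 w0 rho0 wE _ _ _ _ erefl).
  (* Steps before mixing: 2 sqrt(tau) / (cy) <= 4/c because sqrt(tau) <= 2y. *)
  - apply: (le_trans (sum1 tau)).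
    rewrite invfM -mulrA [_ * c^-1]mulrC ler_wpM2l ?invr_ge0 ?(ltW c0)//.
    rewrite mulrC ler_pdivrMr//.
    have : Num.sqrt tau%:R <= 2 * y.
      have -> : 2 * y = Num.sqrt ((2 * y) ^+ 2) by rewrite sqrtr_sqr ger0_norm// mulr_ge0// ltW.
      by rewrite ler_sqrt ?sqr_ge0// exprMn -natrX.
    lra.
  (* Mixing bias: [eps] = 1 / sqrt T cancels the growth sqrt t <= sqrt T of the step sum, and y >=
     1/2 leaves 4/c. *)
  - have sT : 0 < Num.sqrt T%:R :> R by rewrite sqrtr_gt0 ltr0n.
    rewrite /eps mulrC ler_pdivrMr//; apply: (le_trans (sum1 t)).
    rewrite invfM -!mulrA [4 * _]mulrCA ler_wpM2l ?invr_ge0 ?(ltW c0)//.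
    rewrite mulrC ler_pdivrMr//.
    have sqT : Num.sqrt t%:R <= Num.sqrt T%:R :> R by rewrite ler_sqrt// ler_nat.
    have : Num.sqrt T%:R * 2^-1 <= Num.sqrt T%:R * y by rewrite ler_pM2l.
    lra.
  - apply: (le_trans (sum2 t)).
    rewrite exprMn invfM -exprVn -mulrA [12 * _]mulrC ler_wpM2l ?sqr_ge0//.
    by rewrite mulrC ler_pdivrMr ?exprn_gt0//; have := sqr_ge0 (y - 2^-1); lra.
  (* The factor (log T)^2 in tau <= 4 y^2 is cancelled by the 1/y^2 carried by the squared steps. *)
  - apply: (le_trans (ler_wpM2l (ler0n _ _) (sum2 t))).
    rewrite exprMn invfM -exprVn mulrCA -mulrA [12 * _]mulrC ler_wpM2l ?sqr_ge0//.
    by rewrite mulrC ler_pdivrMr ?exprn_gt0//; lra.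
(* Minkowski's inequality passes from the distance to [theta_star] to the norm of the iterate, and
   |theta_star| <= rho supplies the missing [rho]. *)
have -> : w * rho = (w - 1) * rho + rho by ring.
apply: (@le_trans _ _ (traj_expect mu P t
   (fun x => (norm2 (theta x t - theta_star) + norm2 theta_star) ^+ 2))).
  apply: traj_expect_le => // x; rewrite ler_pXn2r ?nnegrE ?norm2_ge0//.
    by rewrite -{1}[td_theta _ _ _ _ _ _](subrK theta_star) norm2D.
  by rewrite addr_ge0 ?norm2_ge0.
apply: traj_expect_minkowski => //; first by rewrite mulr_ge0//; lra.
by rewrite traj_expect_cst// ler_pXn2r ?nnegrE ?norm2_ge0.
Qed.
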